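(* Let $1\le r\le n$ and let $(\mathbf X^s,\mathbf U^s)$ be a stationary pair of stochastic processes. Assume that the stochastic optimal control problem is strictly $L^r$ dissipative at $(\mathbf X^s,\mathbf U^s)$. Then it has the $L^s$ turnpike property (with respect to the same pair $(\mathbf X^s,\mathbf U^s)$) for all $1\le s\le r$.
   Context: Setting. $\mathcal X,\mathcal U,\mathcal W$ are separable Banach spaces, $\|\cdot\|$ is the norm of $\mathcal X$, $(\Omega,\mathcal F,\mathbb P)$ is a probability space, $n,l\ge 1$ are fixed exponents, and $L^n(\Omega,\mathcal F,\mathbb P;\mathcal X)$ is the space of $\mathcal X$-valued random variables with finite $n$-th moment, $\|X\|_{L^r}=\mathbb E[\|X\|^r]^{1/r}$. $f:\mathcal X\times\mathcal U\times\mathcal W\to\mathcal X$ is continuous in $(x,u)$ for almost all $w$. $\mathbf W=(W(0),W(1),\dots)$ is a fixed i.i.d. sequence with distribution $\varrho_W$. The control system is $X(k+1)=f(X(k),U(k),W(k))$, $X(0)=X_0$, with $X(k)\in L^n(\Omega,\mathcal F_k,\mathbb P;\mathcal X)$, $U(k)\in L^l(\Omega,\mathcal F_k,\mathbb P;\mathcal U)$, $\mathcal F_k=\sigma(X(0),\dots,X(k))$; it is always required that $W(k)$ is independent of $(X(k),U(k))$. The trajectory is denoted $X_{\mathbf U}(k,X_0)$ or $X(k)$. The constraint set $\mathbb Y\subseteq L^n(\Omega,\mathcal F,\mathbb P;\mathcal X)\times L^l(\Omega,\mathcal F,\mathbb P;\mathcal U)$ is law-invariant (if $(X,U)\in\mathbb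 Y$ and $(Y,V)$ has the same joint law as $(X,U)$, then $(Y,V)\in\mathbb Y$); $\mathbb X:=\{X : \exists U,\ (X,U)\in\mathbb Y\}$. $\mathbb U^N(X_0)$ is the set of admissible control sequences $\mathbf U=(U(0),\dots,U(N-1))$ for $X_0\in\mathbb X$: $U(k)\in L^l(\Omega,\mathcal F_k,\mathbb P;\mathcal U)$, $(X(k),U(k))\in\mathbb Y$ for $k=0,\dots,N-1$, and $X(N)\in\mathbb X$; $\mathbb U^\infty(X_0)$ is defined analogously for infinite sequences ($(X(k),U(k))\in\mathbb Y$ for all $k\in\mathbb N_0$). It is assumed that $\mathbb U^\infty(X_0)\ne\emptyset$ for all $X_0\in\mathbb X$. The stage cost $\ell:\mathbb Y\to\mathbb R$ is law-invariant ($\ell(X,U)$ depends only on the joint law of $(X,U)$). Markov policies. $\Pi_0(\mathcal X,\mathcal U)$ is the set of (measurable) maps $\pi:\mathcal X\to\mathcal U$ with $\pi\circ X\in L^l(\Omega,\mathcal F,\mathbb P;\mathcal U)$ for all $X\in L^n(\Omega,\mathcal F,\mathbb P;\mathcal X)$. $\mathbb F^N(X_0)$ (for $N\in\mathbb N\cup\{\infty\}$) is the set of $\mathbf U\in\mathbb U^N(X_0)$ such that for every $k<N$ there is $\pi_k\in\Pi_0(\mathcal X,\mathcal U)$ with $U(k)=\pi_k(X(k))$. The stochastic optimal control problem is to minimize $J_N(X_0,\mathbf U)=\sum_{k=0}^{N-1}\ell(X(k),U(k))$ over $\mathbf U\in\mathbb F^N(X_0)$. Stationary pair. $(\mathbf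 X^s,\mathbf U^s)$ with $X^s(k+1)=f(X^s(k),U^s(k),W(k))$ (same noise $\mathbf W$), $\mathbf U^s\in\mathbb F^\infty(X^s(0))$, is stationary if the laws of $X^s(k)$, of $U^s(k)$ and of $(X^s(k),U^s(k))$ do not depend on $k\in\mathbb N_0$. Then $\ell(\mathbf X^s,\mathbf U^s)$ denotes the $k$-independent value $\ell(X^s(k),U^s(k))$. $\mathcal K_\infty$ is the set of continuous, strictly increasing, unbounded $\alpha:[0,\infty)\to[0,\infty)$ with $\alpha(0)=0$. Strict $L^r$ dissipativity at $(\mathbf X^s,\mathbf U^s)$: there exist $\lambda:\mathbb N_0\times L^n(\Omega,\mathcal F,\mathbb P;\mathcal X)\to\mathbb R$ bounded from below and $\alpha\in\mathcal K_\infty$ such that $$\ell(X(k),U(k))-\ell(\mathbf X^s,\mathbf U^s)+\lambda(k,X(k))-\lambda(k+1,X(k+1))\ \ge\ \alpha\big(\mathbb E[\|X(k)-X^s(k)\|^r]\big)$$ for all $k\in\mathbb N_0$, $X_0\in\mathbb X$ and $\mathbf U\in\mathbb F^\infty(X_0)$, where $X(\cdot)=X_{\mathbf U}(\cdot,X_0)$. $L^s$ turnpike property ($s\le n$): there exists $\alpha_1\in\mathcal K_\infty$ such that for each $X_0\in\mathbb X$ there is $C_a>0$ such that for each $\delta>0$, $N\in\mathbb N$, each $\mathbf U\in\mathbb F^N(X_0)$ with $J_N(X_0,\mathbf U)\le\delta+N\ell(\mathbf X^s,\mathbf U^s)$ and each $\varepsilon>0$, $$\#\{k\in\{0,\dots,N\}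 : \mathbb E[\|X_{\mathbf U}(k,X_0)-X^s(k)\|^s]\le\varepsilon\}\ \ge\ N-\frac{\delta+C_a}{\alpha_1(\varepsilon)}.$$
   Formalization: Added assumption: every control in F^N(X_0), N≥1, extends to one in F^∞(X_0); without it the claim is false. Also X_0 is required to be independent of the whole noise W, and nonemptiness of U^∞(X_0) is assumed only for such X_0. *)

(* Defs.v *)
From HB Require Import structures.
From mathcomp Require Import all_boot all_order all_algebra.
From mathcomp Require Import all_classical all_reals all_analysis.

Set Implicit Arguments.
Unset Strict Implicit.
Unset Printing Implicit Defensive.

Import Order.TTheory GRing.Theory Num.Theory.
Import numFieldNormedType.Exports.

Local Open Scope classical_set_scope.
Local Open Scope ring_scope.

(** Random variables are represented by functions on the sample space rather
    than by almost-sure classes.  Everything below that depends on a random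
    variable only through its law is automatically compatible with almost-sure
    equality; the storage function of [strictly_dissipative] is required
    explicitly to be so. *)

Definition separable (T : topologicalType) : Prop :=
  exists2 D : set T, countable D & dense D.

Definition Borel (T : ptopologicalType) := g_sigma_algebraType (@open T).

Section Probability.
Context {R : realType} {d : measure_display} {Omega : measurableType d}.
Variable P : probability Omega R.

Definition same_law {d'} {T : measurableType d'} (f g : Omega -> T) : Prop :=
  forall B : set T, measurable B -> pushforward P f B = pushforward P g B.

Definition independent (G H : set (set Omega)) : Prop :=
  forall A B, G A -> H B -> (P (A `&` B) = P A * P B)%E.

Definition sigma_family {d'} {T : measurableType d'} (I : set nat)
    (Y : nat -> Omega -> T) : set (set Omega) :=
  <<s \bigcup_(i in I) g_sigma_algebra_preimage (Y i) >>.

(** Taking some [B i] to be the whole space shows that initial segments of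
    indices account for all finite subfamilies. *)
Definition iid {d'} {T : measurableType d'} (Y : nat -> Omega -> T)
    (rho : probability T R) : Prop :=
  [/\ forall k, measurable_fun setT (Y k),
      forall k (B : set T), measurable B -> pushforward P (Y k) B = rho B
    & forall m (B : nat -> set T), (forall i, measurable (B i)) ->
        P (\bigcap_(i in `I_m) (Y i @^-1` B i))
        = (\prod_(i < m) P (Y i @^-1` B i))%E].

Definition moment (V : completeNormedModType R) (p : R) (x : Omega -> V) :
  \bar R := 'E_P[fun w => `|x w| `^ p].

Definition Lspace (V : completeNormedModType R) (p : R) (x : Omega -> V) :
    Prop :=
  measurable_fun setT (x : Omega -> Borel V) /\ (moment p x < +oo)%E.

End Probability.

Definition Kinfty (R : realType) (a : R -> R) : Prop :=
  [/\ {within `[0, +oo[%classic, continuous a},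
      {in `[0, +oo[ &, {homo a : x y / x < y}},
      forall M : R, exists2 x, 0 <= x & M < a x
    & a 0 = 0].

(** [None] is the infinite horizon. *)
Definition before (N : option nat) (k : nat) : bool :=
  if N is Some m then (k < m)%N else true.

Definition upto (N : option nat) (k : nat) : bool :=
  if N is Some m then (k <= m)%N else true.

(** [constr] is the set of admissible state-control pairs; [cost] is only
    relevant on it. *)
Record control_problem (R : realType) (d : measure_display)
    (Omega : measurableType d) (X U W : completeNormedModType R) :=
  ControlProblem {
    dyn : X -> U -> W -> X;
    noise : nat -> Omega -> W;
    noise_law : probability (Borel W) R;
    expX : R;
    expU : R;
    constr : set ((Omega -> X) * (Omega -> U));
    cost : (Omega -> X) -> (Omega -> U) -> R
  }.

Section Control.
Context {R : realType} {d : measure_display} {Omega : measurableType d}.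
Variable P : probability Omega R.
Context {X U W : completeNormedModType R}.
Variable S : control_problem Omega X U W.

Implicit Types (x : Omega -> X) (u : Omega -> U) (us : nat -> Omega -> U).

Definition joint x u : Omega -> Borel X * Borel U := fun w => (x w, u w).

Definition stateset : set (Omega -> X) := [set x | exists u, constr S (x, u)].

Fixpoint traj us x0 (k : nat) : Omega -> X :=
  if k is j.+1
  then fun w => dyn S (traj us x0 j w) (us j w) (noise S j w)
  else x0.

(** The noise is independent of the initial state, and each [noise S k] is
    independent of the state and the control at time [k]. *)
Definition noise_independent (N : option nat) x0 us : Prop :=
  independent P (g_sigma_algebra_preimage (x0 : Omega -> Borel X))
    (sigma_family setT (noise S : nat -> Omega -> Borel W)) /\
  forall k, before N k ->
    independent P (g_sigma_algebra_preimage (joint (traj us x0 k) (us k)))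
      (g_sigma_algebra_preimage (noise S k : Omega -> Borel W)).

(** The set U^N(x0).  A control sequence of finite length N is encoded by any
    sequence [us] having it as its first N terms: the later terms are not
    constrained, and nothing that refers to horizon N depends on them. *)
Definition admissible (N : option nat) x0 us : Prop :=
  [/\ stateset x0,
      noise_independent N x0 us,
      forall k, upto N k -> Lspace P (expX S) (traj us x0 k),
      forall k, before N k ->
        [/\ Lspace P (expU S) (us k),
            forall B : set (Borel U), measurable B ->
              sigma_family [set i | (i <= k)%N]
                (traj us x0 : nat -> Omega -> Borel X) (us k @^-1` B)
          & constr S (traj us x0 k, us k)]
    & if N is Some m then stateset (traj us x0 m) else True].

Definition policy (pi : X -> U) : Prop :=
  measurable_fun setT (pi : Borel X -> Borel U) /\
  forall x, Lspace P (expX S) x -> Lspace P (expU S) (pi \o x).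

(** The set F^N(x0). *)
Definition markov_admissible (N : option nat) x0 us : Prop :=
  admissible N x0 us /\
  forall k, before N k ->
    exists2 pi : X -> U, policy pi & us k = pi \o traj us x0 k.

Definition total_cost (N : nat) x0 us : R :=
  \sum_(k < N) cost S (traj us x0 k) (us k).

(** Feasibility is required of the initial states that are independent of the
    noise, the only ones from which the system may be started. *)
Record standing_assumptions : Prop := StandingAssumptions {
  separable_X : separable X;
  separable_U : separable U;
  separable_W : separable W;
  expX_ge1 : 1 <= expX S;
  expU_ge1 : 1 <= expU S;
  dyn_continuous : {ae noise_law S, forall w : Borel W,
    continuous (fun xu : X * U => dyn S xu.1 xu.2 w)};
  noise_iid : iid P (noise S : nat -> Omega -> Borel W) (noise_law S);
  constr_Lspace : forall x u, constr S (x, u) ->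
    Lspace P (expX S) x /\ Lspace P (expU S) u;
  constr_law_invariant : forall x u y v, constr S (x, u) ->
    Lspace P (expX S) y -> Lspace P (expU S) v ->
    same_law P (joint x u) (joint y v) -> constr S (y, v);
  cost_law_invariant : forall x u y v, constr S (x, u) -> constr S (y, v) ->
    same_law P (joint x u) (joint y v) -> cost S x u = cost S y v;
  feasible : forall x0, stateset x0 ->
    independent P (g_sigma_algebra_preimage (x0 : Omega -> Borel X))
      (sigma_family setT (noise S : nat -> Omega -> Borel W)) ->
    exists us, admissible None x0 us
}.

(** Admissible Markov controls on a finite horizon can be continued.  This does
    not follow from [feasible]: from the final state the only admissible
    controls may be feedbacks that fail to map all of L^[expX] into L^[expU],
    or the sample space may carry no copy of the final state that is
    independent of the noise.  Without it, finite-horizon trajectories may be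
    invisible to [strictly_dissipative]. *)
Definition continuable : Prop :=
  forall (x0 : Omega -> X) (N : nat) us, (0 < N)%N ->
    markov_admissible (Some N) x0 us ->
    exists2 vs, markov_admissible None x0 vs &
      forall k, (k < N)%N -> vs k = us k.

Definition stationary_pair (xs : nat -> Omega -> X) us : Prop :=
  [/\ forall k w, xs k.+1 w = dyn S (xs k w) (us k w) (noise S k w),
      markov_admissible None (xs 0) us,
      forall k, same_law P (xs k : Omega -> Borel X) (xs 0),
      forall k, same_law P (us k : Omega -> Borel U) (us 0)
    & forall k, same_law P (joint (xs k) (us k)) (joint (xs 0) (us 0))].

Definition stationary_cost (xs : nat -> Omega -> X) us : R :=
  cost S (xs 0) (us 0).

Definition strictly_dissipative (r : R) (xs : nat -> Omega -> X)
    (uss : nat -> Omega -> U) : Prop :=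
  exists lambda : nat -> (Omega -> X) -> R, exists alpha : R -> R,
  [/\ forall k x y, Lspace P (expX S) x -> Lspace P (expX S) y ->
        {ae P, forall w, x w = y w} -> lambda k x = lambda k y,
      exists M : R, forall k x, Lspace P (expX S) x -> M <= lambda k x,
      Kinfty alpha
    & forall (k : nat) x0 us, stateset x0 -> markov_admissible None x0 us ->
        cost S (traj us x0 k) (us k) - stationary_cost xs uss
          + lambda k (traj us x0 k) - lambda k.+1 (traj us x0 k.+1)
        >= alpha (fine (moment P r (traj us x0 k \- xs k)))].

Definition turnpike (s : R) (xs : nat -> Omega -> X)
    (uss : nat -> Omega -> U) : Prop :=
  exists2 alpha1 : R -> R, Kinfty alpha1 &
  forall x0, stateset x0 ->
  exists2 Ca : R, 0 < Ca &
  forall (delta : R) (N : nat) us, 0 < delta ->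
    markov_admissible (Some N) x0 us ->
    total_cost N x0 us <= delta + N%:R * stationary_cost xs uss ->
  forall eps : R, 0 < eps ->
    (#|[pred k : 'I_N.+1 |
        (moment P s (traj us x0 k \- xs k)%R <= eps%:E)%E]|)%:R
    >= N%:R - (delta + Ca) / alpha1 eps.

End Control.

(* Main.v *)
Require Import Defs.
From mathcomp Require Import all_boot all_order all_algebra.
From mathcomp Require Import all_classical all_reals all_analysis.
From mathcomp Require Import measurable_realfun.
Import Order.TTheory GRing.Theory Num.Theory.
Import numFieldNormedType.Exports.
Local Open Scope ring_scope.

(** Strict dissipativity telescopes.  Along a trajectory it bounds
    [\sum_(k < N) alpha (E|X(k) - Xs(k)|^r)] by the excess of the total cost
    over [N] times the stationary cost, plus [lambda 0 x0] minus a lower bound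
    [M] of the storage function ([sum_dissipation]).  For a control whose excess
    is at most [delta], this sum is therefore at most [delta + Ca], where [Ca]
    depends on the initial state only.

    By Lyapunov's inequality [(E|Z|^s)^(r/s) <= E|Z|^r] ([lyapunov]), an instant
    at which [E|X(k) - Xs(k)|^s > eps] contributes at least
    [alpha1 eps = alpha (eps^(r/s))] to the sum.  Hence there are at most
    [(delta + Ca) / alpha1 eps] such instants among the first [N]
    ([card_le_sum]), and the function [alpha1] is again of class Kinfty
    ([Kinfty_comp], [Kinfty_powR]).

    Dissipativity speaks of infinite-horizon controls, so a control on horizon
    [N] is first continued to an infinite one; trajectories agree up to time [N]
    ([eq_traj]), and [N] is the last time at which the storage function is
    evaluated.

    The comparison of moments requires the r-th moment to be finite and the norm
    of a difference of two Banach-valued random variables to be measurable.  The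
    latter holds because the space is separable ([measurable_dist]). *)

(** * Comparison functions *)

Section Kinfty_closure.
Local Open Scope classical_set_scope.
Local Open Scope ring_scope.
Context {R : realType}.
Implicit Types a b : R -> R.

Lemma Kinfty_ge0 b x : Kinfty b -> 0 <= x -> 0 <= b x.
Proof.
move=> [_ bmono _ b0]; rewrite le_eqVlt => /predU1P[<-|x0]; first by rewrite b0.
by rewrite -b0 ltW// bmono// in_itv/= ?lexx ?ltW.
Qed.

Lemma Kinfty_gt0 b x : Kinfty b -> 0 < x -> 0 < b x.
Proof. by move=> [_ bmono _ b0] x0; rewrite -b0 bmono// in_itv/= ?lexx ?ltW. Qed.

Lemma Kinfty_le b x y : Kinfty b -> 0 <= x -> x <= y -> b x <= b y.
Proof.
move=> [_ bmono _ _] x0; rewrite le_eqVlt => /predU1P[->//|xy].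
by rewrite ltW// bmono// in_itv/= ?x0// (le_trans x0 (ltW xy)).
Qed.

Lemma Kinfty_comp a b : Kinfty a -> Kinfty b -> Kinfty (a \o b).
Proof.
move=> Ka Kb; have b_ge0 := fun x => @Kinfty_ge0 b x Kb.
have [ac amono ainf a0] := Ka; have [bc bmono binf b0] := Kb.
have b_itv x : x \in `[0, +oo[ -> b x \in `[0, +oo[.
  by rewrite !in_itv/= !andbT; exact: b_ge0.
split.
- move/subspace_continuousP : ac => ac; move/subspace_continuousP : bc => bc.
  apply/subspace_continuousP => x x0.
  apply: cvg_comp; last by apply: ac; exact: b_itv.
  move=> B /(bc x x0); rewrite /nbhs/= /within/=.
  by apply: filterS => y Hy y0; apply: Hy => //; exact: b_itv.
- by move=> x y x0 y0 xy; apply: amono; [exact: b_itv|exact: b_itv|exact: bmono].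
- move=> M; have [x x0 Mx] := ainf M; have [y y0 xy] := binf x.
  exists y => //; apply: (lt_trans Mx); apply: amono => //.
    by rewrite in_itv/= x0.
  by rewrite in_itv/= b_ge0.
- by rewrite /= b0.
Qed.

Lemma Kinfty_powR (p : R) : 0 < p -> Kinfty (fun x => x `^ p).
Proof.
move=> p0; split.
- apply/continuous_within_itvcyP; split.
    move=> x x0; apply: differentiable_continuous; apply/derivable1_diffP.
    exact: derivable_powR.
  by rewrite powR0 ?gt_eqF//; exact: powR_cvg0.
- move=> x y; rewrite !in_itv/= !andbT => x0 y0.
  by apply: gt0_ltr_powR => //; rewrite nnegrE.
- move=> M; exists ((`|M| + 1) `^ p^-1); first exact: powR_ge0.
  rewrite -powRrM mulVf ?gt_eqF// powRr1 ?addr_ge0//.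
  by rewrite (le_lt_trans (ler_norm M))// ltrDl.
- by rewrite powR0 ?gt_eqF.
Qed.

End Kinfty_closure.

(** * Measurability and moments *)

Section Moments.
Local Open Scope classical_set_scope.
Local Open Scope ring_scope.
Context {R : realType} {d : measure_display} {Omega : measurableType d}.
Variable P : probability Omega R.
Context {V : completeNormedModType R}.
Implicit Types x y z : Omega -> V.

Lemma momentE p z : moment P p z = (\int[P]_w (`|z w| `^ p)%:E)%E.
Proof. by rewrite /moment unlock. Qed.

Lemma moment_ge0 p z : (0 <= moment P p z)%E.
Proof. by rewrite momentE integral_ge0// => w _; rewrite lee_fin powR_ge0. Qed.

Lemma measurable_dist_cst x (c : V) :
  measurable_fun setT (x : Omega -> Borel V) ->
  measurable_fun setT (fun w => `|x w - c|).
Proof.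
move=> mx; apply: (measurability _ (RGenInftyO.measurableE R)).
move=> /= _ [_ [a ->] <-]; rewrite setTI.
rewrite (_ : _ @^-1` _ = x @^-1` ball c a); last first.
  apply/seteqP; split => w /=; rewrite in_itv/= -ball_normE /= distrC//.
rewrite -[X in measurable X]setTI; apply: mx => //.
by apply: sub_sigma_algebra; exact: ball_open.
Qed.

(** Without separability, subtraction on [V] need not be measurable for the
    product of the Borel sigma-algebras.  With a countable dense set [D], the
    condition [|x - y| < a] says that [|x - c| + |y - c| < a] for some [c] in
    [D], which is a countable union of measurable conditions. *)
Lemma measurable_dist x y : separable V ->
  measurable_fun setT (x : Omega -> Borel V) ->
  measurable_fun setT (y : Omega -> Borel V) ->
  measurable_fun setT (fun w => `|(x \- y) w|).
Proof.
move=> [D cD dD] mx my; apply: (measurability _ (RGenInftyO.measurableE R)).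
move=> /= _ [_ [a ->] <-]; rewrite setTI.
rewrite (_ : _ @^-1` _ = \bigcup_(c in D)
    ((fun w => `|x w - c|) \+ (fun w => `|y w - c|)) @^-1` `]-oo, a[).
  rewrite bigcup_set_type; apply: countable_bigcupT_measurable.
    by rewrite (eq_countable (card_setT D)).
  move=> c; rewrite -[X in measurable X]setTI.
  by apply: measurable_funD; [exact: measurable_dist_cst..| |exact: measurable_itv].
apply/seteqP; split => w /=; rewrite in_itv/=; last first.
  move=> [c _] /=; rewrite in_itv/=; apply: le_lt_trans.
  by rewrite [`|y w - c|]distrC; exact: ler_distD.
move=> xya.
(* The radius is half of the slack in the strict inequality, since the distance
   from y w to c is paid twice. *)
have [c [/= Bc Dc]] : ball (y w) ((a - `|x w - y w|) / 2) `&` D !=set0.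
  apply: dD; last exact: ball_open.
  by exists (y w); apply: ballxx; rewrite divr_gt0// subr_gt0.
exists c => //=; rewrite in_itv/=.
have h : `|x w - c| <= `|x w - y w| + `|y w - c| by exact: ler_distD.
rewrite -ball_normE /= in Bc.
rewrite (le_lt_trans (lerD h (lexx _)))// -addrA -ltrBrDl.
by rewrite [ltRHS]splitr ltrD.
Qed.

(** This gives access to the library's Minkowski inequality and to the inclusions
    between the Lebesgue spaces of a finite measure. *)
Lemma moment_lty_Lfun p z : 0 < p ->
  measurable_fun setT (fun w => `|z w|) ->
  (moment P p z < +oo)%E <-> (fun w => `|z w|) \in Lfun P p%:E.
Proof.
move=> p0 mz; have pn0 : p != 0 by rewrite gt_eqF.
have -> : moment P p z = ('N[P]_p%:E[EFin \o (fun w => `|z w|%R)] `^ p)%E.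
  rewrite poweR_Lnorm// momentE; apply: eq_integral => w _ /=.
  by rewrite normr_id.
split.
  move=> /(lty_poweRy pn0) zfin.
  by rewrite inE; apply/andP; split; rewrite inE.
by rewrite inE => /andP[_]; rewrite inE /= /finite_norm; exact: poweR_lty.
Qed.

(** The function [|x - y|] is dominated by [|x| + |y|], which lies in L^n by
    Minkowski's inequality, and L^n is contained in L^r on a probability
    space. *)
Lemma moment_sub_lty (n r : R) x y : separable V -> 1 <= r -> r <= n ->
  Defs.Lspace P n x -> Defs.Lspace P n y -> (moment P r (x \- y)%R < +oo)%E.
Proof.
move=> sepV r1 rn [mx nx] [my ny].
have n1 : 1 <= n by exact: le_trans rn.
have [r0 n0] : 0 < r /\ 0 < n by rewrite !(lt_le_trans ltr01).
have mnorm z : measurable_fun setT (z : Omega -> Borel V) ->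
    measurable_fun setT (fun w => `|z w|).
  move=> mz; apply: eq_measurable_fun (measurable_dist_cst _ 0 mz).
  by move=> w _; rewrite subr0.
have mxy := measurable_dist _ _ sepV mx my.
have Lx := (moment_lty_Lfun n x n0 (mnorm _ mx)).1 nx.
have Ly := (moment_lty_Lfun n y n0 (mnorm _ my)).1 ny.
have Lsum : (fun w => `|x w| + `|y w|) \in Lfun P n%:E.
  have n1E : (1 <= n%:E)%E by rewrite lee_fin.
  exact: (Lfun_addr_closed P n1E).2 Lx Ly.
apply/moment_lty_Lfun => //.
have PT : P setT \is a fin_num by rewrite probability_setT.
apply: (@Lfun_subset _ _ _ P r%:E n%:E) => //; apply/moment_lty_Lfun => //.
have /integrableP[msum] := Lfun_integrable n1 Lsum.
apply: le_lt_trans; rewrite momentE; apply: ge0_le_integral => //.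
- apply/measurable_EFinP.
  exact: (measurableT_comp (measurable_powR _) mxy).
- exact: measurableT_comp.
- move=> w _; rewrite gee0_abs ?lee_fin ?powR_ge0//.
  rewrite ge0_ler_powR ?nnegrE ?(ltW n0)//.
  by rewrite (le_trans (ler_normB _ _))// ler_norm.
Qed.

(** Hölder's inequality for the product of [|z|^s] and the constant 1, with
    exponent [r / s] on the first factor. *)
Lemma lyapunov (s r : R) z : 0 < s -> s <= r ->
  measurable_fun setT (fun w => `|z w|) ->
  (moment P s z `^ (r / s) <= moment P r z)%E.
Proof.
move=> s0; rewrite le_eqVlt => /predU1P[<- _|sr mz].
  by rewrite divff ?gt_eqF// poweRe1// moment_ge0.
have r0 : 0 < r by exact: lt_trans sr.
pose p := r / s; pose q := (1 - p^-1)^-1.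
have p0 : 0 < p by rewrite divr_gt0.
have q0 : 0 < q by rewrite invr_gt0 subr_gt0 invf_div ltr_pdivrMr// mul1r.
have pq : p^-1 + q^-1 = 1 by rewrite invrK subrKC.
pose f w := `|z w| `^ s.
have mf : measurable_fun setT f.
  exact: (measurableT_comp (measurable_powR _) mz).
have := hoelder P mf (measurable_cst (1 : R)) p0 q0 pq.
rewrite Lnorm_cst1 [X in (X `^ q^-1)%E](@probability_setT _ _ _ P) poweR1r mule1 Lnorm1.
rewrite (_ : integral _ _ _ = moment P s z); last first.
  rewrite momentE; apply: eq_integral => w _ /=.
  by rewrite mulr1 ger0_norm ?powR_ge0.
move=> /(gt0_ler_poweR (ltW p0)).
rewrite poweR_Lnorm ?gt_eqF// !in_itv/= !leey !andbT Lnorm_ge0 moment_ge0.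
move=> /(_ isT isT) /le_trans; apply.
rewrite momentE le_eqVlt; apply/orP; left; apply/eqP; apply: eq_integral => w _ /=.
by rewrite ger0_norm ?powR_ge0// -powRrM mulrCA divff ?mulr1// gt_eqF.
Qed.

End Moments.

(** * Counting *)

(** Markov's inequality for the counting measure on [N] points. *)
Lemma card_le_sum (R : realType) (N : nat) (A : pred 'I_N) (F : 'I_N -> R)
    (c : R) : (forall k, 0 <= F k) -> (forall k, A k -> c <= F k) ->
  c * #|A|%:R <= \sum_k F k.
Proof.
move=> F0 cF; rewrite mulr_natr -sumr_const [leRHS](bigID A)/= -[leLHS]addr0 lerD//.
- exact: ler_sum.
- exact: sumr_ge0.
Qed.

Lemma card_ord_widen (N : nat) (A : pred nat) :
  (#|[pred k : 'I_N | A k]| <= #|[pred k : 'I_N.+1 | A k]|)%N.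
Proof.
by rewrite -!sum1_card big_mkcond [leqRHS]big_mkcond/= big_ord_recr leq_addr.
Qed.

(** * Dissipation along trajectories *)

Section Trajectories.
Local Open Scope classical_set_scope.
Local Open Scope ring_scope.
Context {R : realType} {d : measure_display} {Omega : measurableType d}.
Context {X U W : completeNormedModType R}.
Variable P : probability Omega R.
Variable S : control_problem Omega X U W.
Implicit Types (xs : nat -> Omega -> X) (us vs : nat -> Omega -> U).

Lemma eq_traj us vs (x0 : Omega -> X) k :
  (forall j, (j < k)%N -> vs j = us j) -> traj S vs x0 k = traj S us x0 k.
Proof.
elim: k => //= k IH vu; apply/funext => w.
by rewrite vu// IH// => j jk; apply: vu; rewrite ltnS ltnW.
Qed.

Lemma stationary_traj xs us : stationary_pair P S xs us ->
  forall k, traj S us (xs 0) k = xs k.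
Proof.
by move=> [xsS _ _ _ _]; elim=> //= k IH; apply/funext => w; rewrite IH xsS.
Qed.

(** The storage terms telescope, leaving only their values at times 0 and [N].
    The dissipation inequality is available along an infinite-horizon control
    [vs], whereas the cost is that of a control [us] on horizon [N] which [vs]
    continues. *)
Lemma sum_dissipation (lambda : nat -> (Omega -> X) -> R) (gap : nat -> R)
    (M c : R) x0 us vs N :
  (forall k, (k < N)%N -> vs k = us k) ->
  M <= lambda N (traj S vs x0 N) ->
  (forall k, gap k <= cost S (traj S vs x0 k) (vs k) - c
     + lambda k (traj S vs x0 k) - lambda k.+1 (traj S vs x0 k.+1)) ->
  \sum_(k < N) gap k <= total_cost S N x0 us - N%:R * c + (lambda 0 x0 - M).
Proof.
move=> vu lambdaM diss; pose G k := lambda k (traj S vs x0 k).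
have le_gap : \sum_(k < N) gap k <=
    \sum_(k < N) (cost S (traj S vs x0 k) (vs k) - c - (G k.+1 - G k)).
  by apply: ler_sum => k _; apply: le_trans (diss k) _; rewrite opprB addrA.
apply: (le_trans le_gap).
rewrite sumrB -(big_mkord xpredT (fun k => G k.+1 - G k)) telescope_sumr//.
rewrite sumrB sumr_const card_ord -[c *+ N]mulr_natl.
rewrite (_ : \sum_(k < N) _ = total_cost S N x0 us); last first.
  apply: eq_bigr => k _; rewrite vu// (eq_traj us vs)// => j jk.
  exact/vu/(ltn_trans jk).
by rewrite opprB lerD2l lerD2l lerN2.
Qed.

End Trajectories.

Theorem mainTheorem1 (R : realType) (d : measure_display)
    (Omega : measurableType d) (P : probability Omega R)
    (X U W : completeNormedModType R) (S : control_problem Omega X U W)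
    (hS : standing_assumptions P S) (hC : continuable P S)
    (r : R) (hr1 : 1 <= r) (hrn : r <= expX S)
    (xs : nat -> Omega -> X) (us : nat -> Omega -> U)
    (hstat : stationary_pair P S xs us)
    (hdiss : strictly_dissipative P S r xs us) :
  forall s : R, 1 <= s -> s <= r -> turnpike P S s xs us.
Proof.
move=> s s1 sr.
have [lambda [alpha [_ [M lambdaM] Kalpha diss]]] := hdiss.
have s0 : 0 < s by exact: lt_le_trans s1.
have p0 : 0 < r / s by rewrite divr_gt0// (lt_le_trans s0).
pose alpha1 := alpha \o (fun x : R => x `^ (r / s)).
have Kalpha1 : Kinfty alpha1 by apply: Kinfty_comp => //; exact: Kinfty_powR.
exists alpha1 => // x0 x0S.
exists (`|lambda 0 x0 - M| + 1); first by rewrite ltr_pwDr.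
move=> delta N u delta0 uN costN eps eps0.
have a1eps : 0 < alpha1 eps by exact: Kinfty_gt0.
have Ca0 : 0 < delta + (`|lambda 0 x0 - M| + 1) by rewrite addr_gt0// ltr_pwDr.
(* Only controls on a positive horizon are known to be continuable; on horizon 0
   the lower bound on the number of instants is negative. *)
have [->|N0] := posnP N.
  by rewrite sub0r (le_trans _ (ler0n _ _))// oppr_le0 ltW// divr_gt0.
have [vs vsF vu] := hC x0 N u N0 uN.
have Lv k : Defs.Lspace P (expX S) (traj S vs x0 k) by case: vsF => -[_ _ + _ _] _; exact.
have Lxs k : Defs.Lspace P (expX S) (xs k).
  rewrite -(stationary_traj P S _ _ hstat).
  by case: hstat => _ [[_ _ + _ _] _] _ _ _; exact.
have uv k : (k < N)%N -> traj S vs x0 k = traj S u x0 k.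
  by move=> kN; apply: eq_traj => j jk; apply/vu/(ltn_trans jk).
pose Z k := (traj S vs x0 k \- xs k)%R.
pose m k := fine (moment P r (Z k)).
have m_fin k : moment P r (Z k) \is a fin_num.
  rewrite ge0_fin_numE ?moment_ge0//.
  exact: moment_sub_lty (separable_X hS) hr1 hrn (Lv k) (Lxs k).
have m0 k : 0 <= m k by rewrite fine_ge0// moment_ge0.
pose good k := (moment P s (traj S u x0 k \- xs k)%R <= eps%:E)%E.
(* An infinite r-th moment would be sent to 0 by fine, and a bad instant would
   then contribute nothing to the sum; m_fin excludes this. *)
have bad_large k : (k < N)%N -> ~~ good k -> alpha1 eps <= alpha (m k).
  move=> kN; rewrite /good -uv// -ltNge => epsm.
  apply: (Kinfty_le alpha) => //; first exact: powR_ge0.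
  rewrite -lee_fin fineK// -poweR_EFin.
  apply: (@le_trans _ _ (moment P s (Z k) `^ (r / s))%E).
    apply: (gt0_ler_poweR (ltW p0) _ _ (ltW epsm)).
      by rewrite in_itv/= leey lee_fin ltW.
    by rewrite in_itv/= leey moment_ge0.
  apply: lyapunov => //; apply: measurable_dist; first exact: separable_X hS.
    exact: (Lv k).1.
  exact: (Lxs k).1.
have sum_le := sum_dissipation S lambda (fun k => alpha (m k)) M
  (stationary_cost S xs us) x0 u vs N vu (lambdaM N _ (Lv N))
  (fun k => diss k x0 vs x0S vsF).
pose bad := [pred k : 'I_N | ~~ good k].
have bad_le : alpha1 eps * #|bad|%:R <= delta + (`|lambda 0 x0 - M| + 1).
  apply: (@le_trans _ _ (\sum_(k < N) alpha (m k))).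
    apply: (@card_le_sum _ _ bad (fun k => alpha (m k))) => k.
      exact: Kinfty_ge0.
    exact: bad_large.
  apply: (le_trans sum_le); apply: lerD; first by rewrite lerBlDr.
  by rewrite (le_trans (ler_norm _))// lerDl.
(* The instant N itself is not covered by the sum, so good instants are counted
   among the first N only; including N can only increase their number. *)
have good_bad : N%:R = #|[pred k : 'I_N | good k]|%:R + #|bad|%:R :> R.
  by rewrite -natrD cardC card_ord.
rewrite {1}good_bad lerBlDr lerD//.
  by rewrite ler_nat; exact: (card_ord_widen N good).
by rewrite ler_pdivlMr// mulrC.
Qed.
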